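(* Let $G$ be a finite group and let $p$ be a prime number. If a $p$-Sylow subgroup of the commutator subgroup $[G,G]$ is normal in $G$, then the connected diameter of the $p$-local commensurability graph of $G$ is at most $4$.
   Context: For a group $G$ and a prime $p$, the $p$-local commensurability graph $\Gamma_p(G)$ has as vertices all finite-index subgroups of $G$, and an edge is drawn between (distinct) $A$ and $B$ if $[A: A\cap B][B: A\cap B]$ is a power of $p$ (where $1=p^0$ counts as a power of $p$). The connected diameter of a graph is the supremum, over all connected components of the graph, of the graph diameter of the component. *)

(* Defs.v *)
From mathcomp Require Import all_boot all_fingroup all_solvable.

Set Implicit Arguments.
Unset Strict Implicit.
Unset Printing Implicit Defensive.

Import GroupScope.

Section ConnectedDiameter.

Variables (T : finType) (e : rel T).

Definition walk (n : nat) (x y : T) : bool :=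
  [exists s : n.-tuple T, path e x s && (last x s == y)].

(* The least length of a walk from x to y. A shortest walk has fewer than #|T|
   edges, so the search bound is harmless; the value is #|T| when x and y are
   not connected. *)
Definition distance (x y : T) : nat :=
  find (fun n => walk n x y) (iota 0 #|T|).

(* For a symmetric e, connect e is an equivalence relation. *)
Definition components : {set {set T}} :=
  equivalence_partition (connect e) [set: T].

Definition diameter (C : {set T}) : nat :=
  \max_(x in C) \max_(y in C) distance x y.

Definition connected_diameter : nat := \max_(C in components) diameter C.

Lemma walkP n x y :
  reflect (exists s, [/\ path e x s, last x s = y & size s = n]) (walk n x y).
Proof.
apply: (iffP existsP) => [[s /andP[es /eqP ls]] | [s [es ls /eqP sz]]].
  by exists s; rewrite size_tuple.
by exists (Tuple sz); rewrite /= es ls eqxx.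
Qed.

Lemma connect_walk x y : connect e x y -> exists2 n, n < #|T| & walk n x y.
Proof.
case/connectP=> s es ->; case/shortenP: es => s' es' us' _.
exists (size s'); last by apply/walkP; exists s'.
by rewrite -[(size s').+1]/(size (x :: s')) -(card_uniqP us') max_card.
Qed.

Lemma distance_walk x y : connect e x y -> walk (distance x y) x y.
Proof.
case/connect_walk=> n ltn wn.
have hw : has (fun n => walk n x y) (iota 0 #|T|).
  by apply/hasP; exists n; rewrite // mem_iota.
have := nth_find 0 hw; rewrite nth_iota ?add0n //.
by rewrite -{2}(size_iota 0 #|T|) -has_find.
Qed.

Lemma distance_min n x y : walk n x y -> distance x y <= n.
Proof.
move=> wn; rewrite leqNgt; apply/negP => lt_n.
have lt_nT : n < #|T|.
  apply: leq_trans lt_n _.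
  by rewrite -[leqRHS](size_iota 0) find_size.
by have := before_find 0 lt_n; rewrite nth_iota // add0n wn.
Qed.

End ConnectedDiameter.

Section LocalCommensurability.

Variables (gT : finGroupType) (p : nat) (G : {group gT}).

(* Every subgroup of the finite group G has finite index. *)
Definition subgroup_of : finType := {H : {group gT} | H \subset G}.

Definition commens_edge : rel subgroup_of := fun A B =>
  let: (A', B') := (val A, val B) in
  (A != B) && p.-nat (#|A' : A' :&: B'| * #|B' : A' :&: B'|)%N.

(* For prime p, p.-nat n means that n is a power of p. *)
Lemma commens_edgeP (A B : subgroup_of) : prime p ->
  reflect (A <> B /\ exists k : nat,
             (#|val A : val A :&: val B| * #|val B : val A :&: val B|)%N
               = (p ^ k)%N)
          (commens_edge A B).
Proof.
move=> pr_p; apply: (iffP andP) => [[/eqP nAB /p_natP[k ->]] | [/eqP nAB [k Ek]]].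
  by split=> //; exists k.
by split=> //=; rewrite Ek pnatX pnat_id.
Qed.

Lemma commens_edge_sym : symmetric commens_edge.
Proof. by move=> A B; rewrite /commens_edge eq_sym mulnC setIC. Qed.

End LocalCommensurability.

(* Main.v *)
Require Import Defs.
From mathcomp Require Import all_boot all_fingroup all_solvable.

Set Implicit Arguments.
Unset Strict Implicit.

Import GroupScope.

(** The preimage N of the p'-part of G/[G,G] has p-power index in G and P as
    its normal Sylow p-subgroup, so by Schur-Zassenhaus every A <= G has a Hall
    p'-subgroup Q, and PQ = P(A :&: N) whatever the choice of Q. An edge A - B
    means that a Hall p'-subgroup of A :&: B is one of both A and B, hence
    P(A :&: N) is constant on connected components. Therefore, if A and B are
    connected and Q, R are Hall p'-subgroups of A and B, then PQ = PR and
    A - Q - PQ - R - B is a walk, up to repeated vertices. *)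

Lemma walk_cat (T : finType) (e : rel T) m n (x y z : T) :
  walk e m x y -> walk e n y z -> walk e (m + n) x z.
Proof.
move=> /walkP[s [es <- <-]] /walkP[t [et <- <-]].
by apply/walkP; exists (s ++ t); rewrite cat_path es et last_cat size_cat.
Qed.

Lemma distance_triangle (T : finType) (e : rel T) (x y z : T) :
    connect e x y -> connect e y z ->
  distance e x z <= distance e x y + distance e y z.
Proof.
move=> cxy cyz; apply: distance_min.
exact: walk_cat (distance_walk cxy) (distance_walk cyz).
Qed.

(** By symmetry [connect e] is an equivalence, so two members of a component are connected through
    its representative [z]. *)
Lemma connected_diameter_leq (T : finType) (e : rel T) n :
    symmetric e ->
    (forall x y, connect e x y -> distance e x y <= n) ->
  connected_diameter e <= n.
Proof.
move=> sym_e le_n; apply/bigmax_leqP => C /imsetP[z _ ->].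
apply/bigmax_leqP => x; rewrite !inE => /= czx.
apply/bigmax_leqP => y; rewrite !inE => /= czy; apply: le_n.
by apply: connect_trans czy; rewrite (sym_connect_sym sym_e).
Qed.

Lemma p'Hall_index (gT : finGroupType) (p : nat) (A Q : {group gT}) :
  p^'.-Hall(A) Q -> p.-nat #|A : Q|.
Proof. by case/and3P=> _ _; rewrite pnatNK. Qed.

Section PHall.

Variable gT : finGroupType.
Implicit Types (p : nat) (pi : nat_pred) (A D G N P Q : {group gT}).

(** Multiplicativity of the index along [Q], [D], [A]. With [pi] equal to [p] this moves [P] up to
    [N]; with [p^'] it lifts Hall subgroups through p-power index. *)
Lemma pHall_index_trans pi A D Q :
    D \subset A -> pi^'.-nat #|A : D| -> pi.-Hall(D) Q -> pi.-Hall(A) Q.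
Proof.
move=> sDA iAD /and3P[sQD piQ iDQ].
rewrite /pHall (subset_trans sQD sDA) piQ /=.
by rewrite -(Lagrange_index sDA sQD) pnatM iAD.
Qed.

Lemma ex_normal_p_index_Sylow p G P :
    p.-Sylow([~: G, G]) P -> P <| G ->
  exists N : {group gT}, [/\ N <| G, p.-group (G / N) & p.-Sylow(N) P].
Proof.
move=> sylP nsPG; have nsG'G : G^`(1) <| G := der_normal 1 G.
have abG : abelian (G / G^`(1)) by rewrite sub_der1_abelian.
have hallK := nilpotent_pcore_Hall p^' (abelian_nil abG).
have nsK : 'O_p^'(G / G^`(1)) <| G / G^`(1) by apply: pcore_normal.
(* The p'-core is a Hall subgroup because the abelian quotient is nilpotent; [N] is its preimage. *)
have [N defN sG'N nsNG] := inv_quotientN nsG'G nsK.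
have nsG'N : G^`(1) <| N := normalS sG'N (normal_sub nsNG) nsG'G.
exists N; split=> //.
  rewrite /pgroup card_quotient ?normal_norm //.
  have <- : #|G / G^`(1) : N / G^`(1)| = #|G : N|.
    apply: index_quotient_eq (normal_sub nsNG) (normal_norm nsG'G).
    by rewrite subIset ?sG'N ?orbT.
  by rewrite -defN; apply: p'Hall_index hallK.
have sylP' : p.-Sylow(G^`(1)) P by rewrite derg1.
(* The index of the derived subgroup in [N] is the order of the p'-core, hence prime to [p]. *)
apply: pHall_index_trans sylP' => //.
by rewrite -card_quotient ?normal_norm // -defN -/(pgroup _ _) pcore_pgroup.
Qed.

Section NormalSylow.

Variables (p : nat) (G N P : {group gT}).
Hypotheses (nsPG : P <| G) (nsNG : N <| G) (pGN : p.-group (G / N)).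
Hypothesis sylP : p.-Sylow(N) P.

Let sPN : P \subset N := pHall_sub sylP.

(** This index is the order of the image of [A] in the p-group [G / N]. *)
Lemma p_index_setI A : A \subset G -> p.-nat #|A : A :&: N|.
Proof.
move=> sAG; rewrite indexgI -card_quotient; last first.
  exact: subset_trans sAG (normal_norm nsNG).
by apply: pgroupS pGN; apply: quotientS.
Qed.

Lemma normal_Sylow_setI A :
  A \subset G -> p.-Sylow(A :&: N) (A :&: P) /\ A :&: P <| A :&: N.
Proof.
move=> sAG; have nsPN : P <| N := normalS sPN (normal_sub nsNG) nsPG.
have defAP : P :&: (A :&: N) = A :&: P.
  by rewrite setIC -setIA (setIidPr sPN).
split; first by rewrite -defAP; apply: setI_normal_Hall sylP (subsetIr _ _).
by rewrite -defAP setIC; apply: normalGI (subsetIr _ _) nsPN.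
Qed.

Lemma ex_p'Hall A : A \subset G -> exists Q : {group gT}, p^'.-Hall(A) Q.
Proof.
move=> sAG; have [sylAP nsAP] := normal_Sylow_setI sAG.
have /splitsP[Q /complP[tiQ defAN]] :=
  SchurZassenhaus_split (pHall_Hall sylAP) nsAP.
exists Q; apply: pHall_index_trans (subsetIl A N) _ _.
  by rewrite pnatNK p_index_setI.
(* It remains to see that [#|Q|] is the p'-part of [#|A :&: N|]: cancel the p-part, which is
   [#|A :&: P|]. *)
rewrite pHallE -{1}defAN mulG_subr /=.
have := TI_cardMg tiQ; rewrite defAN (card_Hall sylAP) => cAN.
by rewrite -(eqn_pmul2l (part_gt0 p #|A :&: N|)) -cAN partnC.
Qed.

(** The p'-group [Q] has trivial image in the p-group [G / N], so it lies in [N] and complements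
    [A :&: P] in [A :&: N]; then [P] absorbs [A :&: P]. *)
Lemma mulg_p'Hall A Q :
  A \subset G -> p^'.-Hall(A) Q -> P * Q = P * (A :&: N).
Proof.
move=> sAG hallQ; have [sylAP nsAP] := normal_Sylow_setI sAG.
have [sQA p'Q _] := and3P hallQ; have sQG := subset_trans sQA sAG.
have sQN : Q \subset N.
  rewrite -quotient_sub1 ?(subset_trans sQG) ?normal_norm //.
  rewrite -(coprime_TIg (pnat_coprime pGN (quotient_pgroup N p'Q))).
  by rewrite subsetI quotientS /=.
have hallQN : p^'.-Hall(A :&: N) Q.
  by apply: pHall_subl hallQ; rewrite ?subsetIl // subsetI sQA.
have /sdprodP[_ <- _ _] := sdprod_normal_p'HallP nsAP hallQN sylAP.
by rewrite mulgA (mulGSid (subsetIr A P)).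
Qed.

End NormalSylow.

End PHall.

Section Commensurability.

Variables (gT : finGroupType) (p : nat) (G : {group gT}).
Let edge := @commens_edge gT p G.

Lemma p'Hall_connect (A Q : subgroup_of G) :
    p^'.-Hall(val A) (val Q) ->
  [/\ connect edge A Q, connect edge Q A, distance edge A Q <= 1
    & distance edge Q A <= 1].
Proof.
(* Edges join distinct vertices only, so [A = Q] needs the empty walk. *)
move=> hallQ; have [<- | neqAQ] := eqVneq A Q.
  suff d0 : distance edge A A <= 1 by rewrite connect0.
  by apply: leq_trans (leq0n 1); apply: distance_min; apply/walkP; exists [::].
have eAQ : edge A Q.
  rewrite /edge /commens_edge neqAQ (setIidPr (pHall_sub hallQ)) indexgg muln1.
  exact: p'Hall_index hallQ.
have eQA : edge Q A by rewrite /edge commens_edge_sym.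
by split; do ?exact: connect1; apply: distance_min; apply/walkP;
  [exists [:: Q] | exists [:: A]]; rewrite /= ?eAQ ?eQA.
Qed.

Lemma commens_edge_p'Hall (A B : subgroup_of G) (Q : {group gT}) :
    edge A B -> p^'.-Hall(val A :&: val B) Q ->
  p^'.-Hall(val A) Q /\ p^'.-Hall(val B) Q.
Proof.
case/andP=> _; rewrite pnatM => /andP[iA iB] hallQ.
by split; apply: pHall_index_trans hallQ; rewrite ?subsetIl ?subsetIr ?pnatNK.
Qed.

End Commensurability.

Theorem theorem2 (gT : finGroupType) (G : {group gT}) (p : nat) (P : {group gT}) :
  prime p -> p.-Sylow([~: G, G]) P -> P <| G ->
  connected_diameter (@commens_edge gT p G) <= 4.
Proof.
move=> pr_p sylG'P nsPG.
have [N [nsNG pGN sylP]] := ex_normal_p_index_Sylow sylG'P nsPG.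
set edge := @commens_edge gT p G.
have mulP := mulg_p'Hall nsPG nsNG pGN sylP.
have exHall := ex_p'Hall nsPG nsNG pGN sylP.
have edge_inv (A B : subgroup_of G) :
  edge A B -> P * (val A :&: N) = P * (val B :&: N).
- have sABG := subset_trans (subsetIl (val A) (val B)) (valP A).
  move=> eAB; have [Q hallQ] := exHall _ sABG.
  have [hallA hallB] := commens_edge_p'Hall eAB hallQ.
  by rewrite -(mulP _ _ (valP A) hallA) -(mulP _ _ (valP B) hallB).
apply: connected_diameter_leq => [|A B cAB]; first exact: commens_edge_sym.
have eqAB : P * (val A :&: N) = P * (val B :&: N).
  have [s es ->] := connectP cAB.
  by elim: s A es {cAB} => //= C s IHs A /andP[/edge_inv-> /IHs].
have [Q hallQ] := exHall _ (valP A); have [R hallR] := exHall _ (valP B).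
have sQG := subset_trans (pHall_sub hallQ) (valP A).
have sRG := subset_trans (pHall_sub hallR) (valP B).
have eqPQR : P * Q = P * R.
  by rewrite (mulP _ _ (valP A) hallQ) (mulP _ _ (valP B) hallR).
have sPG := normal_sub nsPG; have nPG := normal_norm nsPG.
have sZG : P <*> Q \subset G by rewrite join_subG sPG.
(* Stated for any [S] so as to cover both [Q] and [R]. Since [P] and [S] have coprime orders, the
   index of [S] in [P * S] is [#|P|]. *)
have hallZ (S : {group gT}) :
    p^'.-group S -> P * S = P * Q -> p^'.-Hall(P <*> Q) S.
- move=> p'S eqS; have pP := pHall_pgroup sylP.
  have defZ : P <*> Q = P * S by rewrite norm_joinEr ?(subset_trans sQG).
  have sSZ : S \subset P <*> Q by rewrite defZ mulG_subr.
  rewrite /pHall sSZ p'S pnatNK -divgS //= defZ.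
  by rewrite (TI_cardMg (coprime_TIg (pnat_coprime pP p'S))) mulnK ?cardG_gt0.
pose Q' : subgroup_of G := Sub Q sQG; pose R' : subgroup_of G := Sub R sRG.
pose Z' : subgroup_of G := Sub (P <*> Q)%G sZG.
have [cAQ _ dAQ _] := p'Hall_connect (A := A) (Q := Q') hallQ.
have [_ cRB _ dRB] := p'Hall_connect (A := B) (Q := R') hallR.
have [_ cQZ _ dQZ] := p'Hall_connect (A := Z') (Q := Q')
  (hallZ Q (pHall_pgroup hallQ) erefl).
have [cZR _ dZR _] := p'Hall_connect (A := Z') (Q := R')
  (hallZ R (pHall_pgroup hallR) (esym eqPQR)).
have cAZ := connect_trans cAQ cQZ; have cZB := connect_trans cZR cRB.
(* The walk is cut at its midpoint [Z']; each half passes through one Hall subgroup and costs at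
   most two edges. *)
apply: leq_trans (distance_triangle cAZ cZB) _; rewrite -[4]/(2 + 2).
apply: leq_add.
  by apply: leq_trans (distance_triangle cAQ cQZ) _; apply: (leq_add dAQ dQZ).
by apply: leq_trans (distance_triangle cZR cRB) _; apply: (leq_add dZR dRB).
Qed.
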